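(* Let $\mathcal A,\mathcal B$ be unital pro-$C^*$-algebras, $E$ a full Hilbert $\mathcal A$-module, $F$ a Hilbert $\mathcal{BB}$-module, and let $\Phi,\Psi\in\mathcal{CP}(E,F)$ with Stinespring constructions $(\pi_\Phi,K_\phi,K_\Phi,V_\phi,W_\Phi)$ and $(\pi_\Psi,K_\psi,K_\Psi,V_\psi,W_\Psi)$. Then the following are equivalent: (1) $\Phi\sim\Psi$; (2) there are unitary operators $U_1:K_\phi\to K_\psi$ and $U_2:K_\Phi\to K_\Psi$ such that, with $V:=W_\Phi^*U_2^*W_\Psi\in\mathcal L_{\mathcal B}(F)$, (i) $V_\psi=U_1V_\phi$; (ii) $U_2\pi_\Phi(x)=\pi_\Psi(x)U_1$ for all $x\in E$; (iii) $W_\Phi=U_2^*W_\Psi V^*$.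
   Context: A pro-$C^*$-algebra is a complex $*$-algebra that is complete and Hausdorff for the locally convex topology of a family of submultiplicative, $*$-invariant seminorms $p$ with $p(x^*x)=p(x)^2$; $S(\mathcal A)$ is the set of continuous such seminorms on $\mathcal A$. An element is positive if it has the form $b^*b$. A linear map $\phi:\mathcal A\to\mathcal B$ is completely positive if every entrywise map $\phi^{(n)}:M_n(\mathcal A)\to M_n(\mathcal B)$ sends positive elements to positive elements. A Hilbert $\mathcal A$-module is a right $\mathcal A$-module with an $\mathcal A$-valued inner product (linear in the second variable, positive definite), complete for the seminorms $\|\xi\|_p=\sqrt{p(\langle\xi,\xi\rangle)}$, $p\in S(\mathcal A)$; it is full if the closed linear span of all inner products is $\mathcal A$. $\mathcal L_{\mathcal B}(G,H)$ denotes the bounded (for each $p$) adjointable $\mathcal B$-linear maps between Hilbert $\mathcal B$-modules, $\mathcal L_{\mathcal B}(G)=\mathcal L_{\mathcal B}(G,G)$; unitary means adjointable with $U^*U=I$, $UU^*=I$. A Hilbert $\mathcal{BB}$-module (two-sided Hilbert $\mathcal B$-module) is a Hilbert $\mathcal B$-module $G$ with a non-degenerate $*$-homomorphism $\tau:\mathcal B\to\mathcal L_{\mathcal B}(G)$; one writes $b\cdot g=\tau(b)g$ and $bI_G=\tau(b)$. $[\,\cdot\,]$ denotes closed linear span. For a linear map $\phi:\mathcal A\to\mathcal B$, a map $\Phi:E\to F$ is a $\phi$-map if $\langle\Phi(x),\Phi(y)\rangle=\phi(\langle x,y\rangle)$ for all $x,y\in E$. $\mathcal{CP}(E,F)$ is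 the set of maps $\Phi:E\to F$ that are $\phi$-maps for some continuous completely positive $\phi:\mathcal A\to\mathcal B$; since $E$ is full, $\phi$ is determined by $\Phi$, and $\phi,\psi$ denote the maps associated with $\Phi,\Psi$. Write $\Phi\sim\Psi$ if $\langle\Phi(x),\Phi(x)\rangle=\langle\Psi(x),\Psi(x)\rangle$ for all $x\in E$. Stinespring construction: each $\Phi\in\mathcal{CP}(E,F)$ with associated $\phi$ has attached to it $(\pi_\Phi,K_\phi,K_\Phi,V_\phi,W_\Phi)$ together with a two-sided Hilbert $\mathcal B$-module $D$ (the module associated with $\mathcal B\otimes X$, where $X$ is the GNS module with GNS vector $\xi$) and the vector $1_{\mathcal B}\otimes\xi\in D$. Here $K_\phi,K_\Phi$ are Hilbert $\mathcal B$-modules; $\pi_\phi:\mathcal A\to\mathcal L_{\mathcal B}(K_\phi)$ is a unital continuous $*$-representation; $\pi_\Phi:E\to\mathcal L_{\mathcal B}(K_\phi,K_\Phi)$ satisfies $\pi_\Phi(x)^*\pi_\Phi(y)=\pi_\phi(\langle x,y\rangle)$ and $\pi_\Phi(xa)=\pi_\Phi(x)\pi_\phi(a)$; $V_\phi\in\mathcal L_{\mathcal B}(D,K_\phi)$, and $W_\Phi\in\mathcal L_{\mathcal B}(F,K_\Phi)$ is a co-isometry ($W_\Phi W_\Phi^*=I$); $\phi(a)I_D=V_\phi^*\pi_\phi(a)V_\phi$ for $a\in\mathcal A$; $\Phi(z)=W_\Phi^*\pi_\Phi(z)V_\phi(1_{\mathcal B}\otimes\xi)$ for $z\in E$; and minimality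 holds: $[\pi_\phi(\mathcal A)V_\phi D]=K_\phi$, $[\pi_\Phi(E)V_\phi D]=K_\Phi$. The same $D$ and $1_{\mathcal B}\otimes\xi$ are used for $\Phi$ and $\Psi$. *)

(* Defs.v *)
From HB Require Import structures.
From mathcomp Require Import all_boot all_order all_algebra.
From mathcomp Require Export complex.
From mathcomp Require Import boolp classical_sets functions reals topology.
From mathcomp Require Import normedtype.

Set Implicit Arguments.
Unset Strict Implicit.
Unset Printing Implicit Defensive.

Import Order.TTheory GRing.Theory Num.Theory.
Import numFieldNormedType.Exports.
Local Open Scope classical_set_scope.
Local Open Scope ring_scope.
Local Open Scope complex_scope.

Definition cstar_seminorm (R : realType) (A : lmodType R[i])
    (mul : A -> A -> A) (star : A -> A) (p : A -> R) : Prop :=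
  [/\ forall x y, p (x + y) <= p x + p y,
      forall (c : R[i]) x, p (c *: x) = Normc.normc c * p x,
      forall x y, p (mul x y) <= p x * p y,
      forall x, p (star x) = p x &
      forall x, p (mul (star x) x) = p x ^+ 2].

(* The multiplication is part of the mixin because [algType] would exclude the
   zero algebra; an instance of [pzRingType] is declared below.  The entourage
   axiom says that the uniform structure is the one of the continuous
   C*-seminorms.  This is the same as being given by some family of
   C*-seminorms; and, as the continuous C*-seminorms are closed under binary
   maxima, balls of a single one suffice. *)
HB.mixin Record isProCStar (R : realType) A of Tvs R[i] A := {
  pc_mul : A -> A -> A ;
  pc_one : A ;
  star : A -> A ;
  pc_mulA : associative pc_mul ;
  pc_mul1r : left_id pc_one pc_mul ;
  pc_mulr1 : right_id pc_one pc_mul ;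
  pc_mulDl : left_distributive pc_mul +%R ;
  pc_mulDr : right_distributive pc_mul +%R ;
  pc_scaleAl : forall (c : R[i]) x y, c *: pc_mul x y = pc_mul (c *: x) y ;
  pc_scaleAr : forall (c : R[i]) x y, c *: pc_mul x y = pc_mul x (c *: y) ;
  starK : involutive star ;
  starD : forall x y, star (x + y) = star x + star y ;
  starZ : forall (c : R[i]) x, star (c *: x) = Num.conj c *: star x ;
  starM : forall x y, star (pc_mul x y) = pc_mul (star y) (star x) ;
  procstar_hausdorff : hausdorff_space A ;
  procstar_complete : forall F : set_system A,
    ProperFilter F -> cauchy F -> exists x : A, F --> x ;
  procstar_entourage : forall D : set (A * A), entourage D <->
    exists p : A -> R, (cstar_seminorm pc_mul star p /\ continuous p) /\
      exists2 e : R, 0 < e & [set xy | p (xy.1 - xy.2) < e] `<=` D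
}.

#[short(type="proCStarType")]
HB.structure Definition ProCStar (R : realType) :=
  {A of isProCStar R A & Tvs R[i] A}.

HB.instance Definition _ (R : realType) (A : proCStarType R) :=
  GRing.Zmodule_isPzRing.Build A
    pc_mulA pc_mul1r pc_mulr1 pc_mulDl pc_mulDr.

Definition cstar_seminorms (R : realType) (A : proCStarType R) :
    set (A -> R) :=
  [set p : A -> R | @cstar_seminorm R A *%R star p /\ continuous p].

Arguments cstar_seminorms {R} A.

Definition positive (R : realType) (A : proCStarType R) (x : A) : Prop :=
  exists b : A, x = star b * b.

(* The topology of a Hilbert module is that of the seminorms
   [Num.sqrt (p (inner x x))], which satisfy the triangle inequality by the
   Cauchy-Schwarz inequality; it is locally convex, hence the [Tvs] structure. *)
HB.mixin Record isHilbertMod (R : realType) (A : proCStarType R) E of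
    Tvs R[i] E := {
  ract : E -> A -> E ;
  inner : E -> E -> A ;
  ractDl : forall x y a, ract (x + y) a = ract x a + ract y a ;
  ractDr : forall x a b, ract x (a + b) = ract x a + ract x b ;
  ractM : forall x a b, ract x (a * b) = ract (ract x a) b ;
  ract1 : forall x, ract x 1 = x ;
  ractZl : forall (c : R[i]) x a, ract (c *: x) a = c *: ract x a ;
  ractZr : forall (c : R[i]) x a, ract x (c *: a) = c *: ract x a ;
  innerDr : forall x y z, inner x (y + z) = inner x y + inner x z ;
  innerZr : forall (c : R[i]) x y, inner x (c *: y) = c *: inner x y ;
  inner_ract : forall x y a, inner x (ract y a) = inner x y * a ;
  star_inner : forall x y, star (inner x y) = inner y x ;
  inner_positive : forall x, positive (inner x x) ;
  inner_eq0 : forall x, inner x x = 0 -> x = 0 ;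
  hilbert_complete : forall X : set_system E,
    ProperFilter X -> cauchy X -> exists x : E, X --> x ;
  hilbert_entourage : forall D : set (E * E), entourage D <->
    exists2 p : A -> R, cstar_seminorms A p & exists2 e : R, 0 < e &
      [set xy | Num.sqrt (p (inner (xy.1 - xy.2) (xy.1 - xy.2))) < e] `<=` D
}.

#[short(type="hilbertModType")]
HB.structure Definition HilbertMod (R : realType) (A : proCStarType R) :=
  {E of isHilbertMod R A E & Tvs R[i] E}.

Definition hnorm (R : realType) (A : proCStarType R) (E : hilbertModType A)
    (p : A -> R) (x : E) : R := Num.sqrt (p (inner x x)).

Definition closed_span (R : realType) (E : tvsType R[i]) (X : set E) : set E :=
  closure [set x | exists n (c : 'I_n -> R[i]) (s : 'I_n -> E),
    (forall i, X (s i)) /\ x = \sum_(i < n) c i *: s i].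

Definition full (R : realType) (A : proCStarType R) (E : hilbertModType A) :=
  closed_span [set a : A | exists x y : E, a = inner x y] = [set: A].

(* The space of operators L_B(G, H).  The adjoint is stored as data; it is
   unique because inner products are definite. *)
Record adjop (R : realType) (B : proCStarType R) (G H : hilbertModType B) :=
  AdjOp {
    op :> G -> H ;
    adj : H -> G ;
    op_linear : linear op ;
    op_ract : forall g b, op (ract g b) = ract (op g) b ;
    op_adj : forall g h, inner (op g) h = inner g (adj h) ;
    op_bounded : forall p, cstar_seminorms B p ->
      exists M : R, forall g, hnorm p (op g) <= M * hnorm p g
  }.

Definition unitary (R : realType) (B : proCStarType R)
    (G H : hilbertModType B) (U : adjop G H) : Prop :=
  adj U \o U =1 id /\ U \o adj U =1 id.

Definition coisometry (R : realType) (B : proCStarType R)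
    (G H : hilbertModType B) (W : adjop G H) : Prop :=
  W \o adj W =1 id.

Definition star_hom (R : realType) (A B : proCStarType R)
    (G : hilbertModType B) (rho : A -> adjop G G) : Prop :=
  [/\ forall (c : R[i]) a b g, rho (c *: a + b) g = c *: rho a g + rho b g,
      forall a b, rho (a * b) =1 rho a \o rho b &
      forall a, rho (star a) =1 adj (rho a)].

Definition op_seminorm (R : realType) (B : proCStarType R)
    (G H : hilbertModType B) (p : B -> R) (T : G -> H) : R :=
  sup [set hnorm p (T g) | g in [set g | hnorm p g <= 1]].

(* Continuity for the topology of L_B(G) given by the seminorms
   [op_seminorm p], p in S(B). *)
Definition continuous_rep (R : realType) (A B : proCStarType R)
    (G : hilbertModType B) (rho : A -> adjop G G) : Prop :=
  forall p, cstar_seminorms B p -> forall a0 : A,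
    op_seminorm p (fun g => rho a g - rho a0 g) @[a --> a0] --> (0 : R).

Record twoSidedModType (R : realType) (B : proCStarType R) := TwoSidedMod {
  two_sided_sort :> hilbertModType B ;
  tau : B -> adjop two_sided_sort two_sided_sort ;
  tau_hom : star_hom tau ;
  tau_nondegenerate :
    closed_span [set x | exists b g, x = tau b g] = [set: two_sided_sort]
}.

Definition mx_positive (R : realType) (A : proCStarType R) (n : nat)
    (X : 'M[A]_n) : Prop :=
  exists Y : 'M[A]_n, X = (map_mx star Y)^T *m Y.

Definition completely_positive (R : realType) (A B : proCStarType R)
    (phi : A -> B) : Prop :=
  forall (n : nat) (X : 'M[A]_n), mx_positive X -> mx_positive (map_mx phi X).

Section CP.
Variables (R : realType) (A B : proCStarType R).
Variables (E : hilbertModType A) (F : hilbertModType B).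

Definition phi_map (phi : A -> B) (Phi : E -> F) : Prop :=
  forall x y, inner (Phi x) (Phi y) = phi (inner x y).

(* Phi belongs to CP(E, F) and phi is its associated map. *)
Definition CP_with (phi : {linear A -> B}) (Phi : E -> F) : Prop :=
  [/\ continuous phi, completely_positive phi & phi_map phi Phi].

Definition sim (Phi Psi : E -> F) : Prop :=
  forall x, inner (Phi x) (Phi x) = inner (Psi x) (Psi x).

(* Only the listed relations tie the two-sided module D and its vector d0 to
   the rest; in the Stinespring construction D comes from B (x) X, where X is
   the GNS module with GNS vector xi, and d0 is 1 (x) xi. *)
Record stinespring (D : twoSidedModType B) (d0 : D)
    (phi : A -> B) (Phi : E -> F) := Stinespring {
  K_phi : hilbertModType B ;
  K_Phi : hilbertModType B ;
  pi_phi : A -> adjop K_phi K_phi ;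
  pi_Phi : E -> adjop K_phi K_Phi ;
  V_phi : adjop D K_phi ;
  W_Phi : adjop F K_Phi ;
  pi_phi_hom : star_hom pi_phi ;
  pi_phi_unital : pi_phi 1 =1 id ;
  pi_phi_continuous : continuous_rep pi_phi ;
  pi_Phi_inner : forall x y, adj (pi_Phi x) \o pi_Phi y =1 pi_phi (inner x y) ;
  pi_Phi_ract : forall x a, pi_Phi (ract x a) =1 pi_Phi x \o pi_phi a ;
  W_Phi_coisometry : coisometry W_Phi ;
  phi_dilation : forall a, tau D (phi a) =1 adj V_phi \o pi_phi a \o V_phi ;
  Phi_dilation : forall z, Phi z = adj W_Phi (pi_Phi z (V_phi d0)) ;
  minimal1 : closed_span [set k | exists a d, k = pi_phi a (V_phi d)] = [set: K_phi] ;
  minimal2 : closed_span [set k | exists z d, k = pi_Phi z (V_phi d)] = [set: K_Phi]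
}.

End CP.

(* Main.v *)
From HB Require Import structures.
From mathcomp Require Import all_boot all_order all_algebra.
From mathcomp Require Import boolp classical_sets functions reals topology.
From mathcomp Require Import normedtype ring lra.
Require Import Defs.
Import Order.TTheory GRing.Theory Num.Theory.
Local Open Scope classical_set_scope.
Local Open Scope ring_scope.
Local Open Scope complex_scope.
Set Implicit Arguments.
Unset Strict Implicit.
Unset Printing Implicit Defensive.

(** The associated maps decide everything.  By polarization and linearity,
    $\Phi\sim\Psi$ says that $\phi$ and $\psi$ agree on all inner products
    of $E$; these are total in $A$ because $E$ is full, so by continuity it says
    that $\phi=\psi$ ([sim_phi_eq]).

    The spanning vectors $\pi_\phi(a)V_\phi d$ and $\pi_\Phi(z)V_\phi d$ have
    Gram matrices $\langle d,\phi(a^*a')d'\rangle$ and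
    $\langle d,\phi(\langle z,z'\rangle)d'\rangle$, which involve only $\phi$
    and $D$.  So when $\phi=\psi$ the two constructions have spanning families
    with equal Gram matrices, and such families correspond under a unitary
    ([unitary_of_gram]).  This produces $U_1$ and $U_2$; the intertwining
    relations hold on spanning vectors, hence everywhere
    ([stinespring_unique]).  Relation (iii) is a formal consequence of
    $W_\Psi W_\Psi^*=I$ and $U_2^*U_2=I$.

    Conversely, $W_\Phi^*$ is isometric, so
    $\langle\Phi(x),\Phi(x)\rangle$ is the square of
    $\pi_\Phi(x)V_\phi(1\otimes\xi)$, which $U_2$ preserves and carries to the
    corresponding vector of $\Psi$.

    The analytic input is the continuity of the inner product
    ([inner_continuous]).  It is derived from polarization and the continuity
    of addition instead of the Cauchy-Schwarz inequality, that is, from the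
    linear topology of the module instead of the order of the algebra. *)

(** * Continuous maps on closures and closed spans *)

Lemma continuous_eq_on_closure (S : topologicalType) (T : topologicalType)
    (f g : S -> T) (X : set S) :
  hausdorff_space T -> continuous f -> continuous g ->
  (forall x, X x -> f x = g x) -> forall x, closure X x -> f x = g x.
Proof.
move=> hT cf cg efg x clx; apply: hT => N M fN gM.
have [z [Xz [Nz Mz]]] := clx _ (filterI (F := nbhs x) (cf x _ fN) (cg x _ gM)).
by exists (f z); split=> //; rewrite efg.
Qed.

Lemma linear_eq_on_closed_span (R : realType) (E F : tvsType R[i])
    (f g : {linear E -> F}) (X : set E) :
  hausdorff_space F -> continuous f -> continuous g ->
  closed_span X = [set: E] -> (forall x, X x -> f x = g x) -> f =1 g.
Proof.
move=> hF cf cg spanX efg x.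
have: closed_span X x by rewrite spanX.
apply: (continuous_eq_on_closure hF cf cg) => y [n [c [s [Xs ->]]]].
rewrite !linear_sum; apply: eq_bigr => i _.
by rewrite !linearZ /= efg.
Qed.

(** * Seminorms and polarization in Hilbert modules *)

Lemma nbhs_procstarP (R : realType) (A : proCStarType R) (x : A) (N : set A) :
  nbhs x N <-> exists2 p, cstar_seminorms A p &
    exists2 e : R, 0 < e & forall y, p (x - y) < e -> N y.
Proof.
rewrite -nbhs_entourageE; split.
  move=> [D /procstar_entourage[p [Sp [e e0 pD]]] DN].
  exists p => //; exists e => // y pxy; apply: DN; rewrite /xsection /= inE.
  exact: (pD (x, y)).
move=> [p Sp [e e0 pN]]; exists [set xy | p (xy.1 - xy.2) < e].
  by apply/procstar_entourage; exists p; split=> //; exists e.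
by move=> y; rewrite /xsection /= inE /=; apply: pN.
Qed.

Lemma addr_parallelogram (V : zmodType) (a b c d : V) :
  (a + b + (c + d)) - ((a - b) - (c - d)) = (b + c) *+ 2.
Proof.
rewrite !opprB [X in _ + X]addrC addrACA (addrC a b) (addrACA b a) subrr.
by rewrite (addrACA c d) subrr !addr0 addrACA mulr2n.
Qed.

Section HilbertModule.
Variables (R : realType) (A : proCStarType R) (E : hilbertModType A).
Implicit Types (p : A -> R) (x y z u : E).

Lemma hilbert_ball_entourage p (e : R) : cstar_seminorms A p -> 0 < e ->
  entourage [set xy : E * E | hnorm p (xy.1 - xy.2) < e].
Proof.
by move=> Sp e0; apply/hilbert_entourage; exists p => //; exists e.
Qed.

Lemma nbhs_hilbertP x (N : set E) :
  nbhs x N <-> exists2 p, cstar_seminorms A p &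
    exists2 e : R, 0 < e & forall y, hnorm p (x - y) < e -> N y.
Proof.
rewrite -nbhs_entourageE; split=> [[D /hilbert_entourage[p Sp [e e0 pD]] DN]|].
  exists p => //; exists e => // y pxy; apply: DN; rewrite /xsection /= inE.
  exact: (pD (x, y)).
move=> [p Sp [e e0 pN]]; exists [set xy | hnorm p (xy.1 - xy.2) < e].
  exact: hilbert_ball_entourage.
by move=> y; rewrite /xsection /= inE /=; apply: pN.
Qed.

Fact inner_is_linear u : linear (inner u : E -> A).
Proof. by move=> c x y; rewrite innerDr innerZr. Qed.

HB.instance Definition _ u :=
  GRing.isLinear.Build R[i] E A *:%R (inner u : E -> A) (inner_is_linear u).

Lemma innerDl x y z : inner (x + y) z = inner x z + inner y z :> A.
Proof. by rewrite -star_inner innerDr starD !star_inner. Qed.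

Lemma innerZl (c : R[i]) x z : inner (c *: x) z = Num.conj c *: inner x z :> A.
Proof. by rewrite -star_inner innerZr starZ star_inner. Qed.

Lemma innerBl x y z : inner (x - y) z = inner x z - inner y z :> A.
Proof. by rewrite -(scaleN1r y) innerDl innerZl rmorphN1 scaleN1r. Qed.

Lemma innerBr x y z : inner x (y - z) = inner x y - inner x z :> A.
Proof. exact: raddfB. Qed.

Lemma inner_eq x y : (forall z, inner z x = inner z y :> A) -> x = y.
Proof.
move=> exy; apply/eqP; rewrite -subr_eq0; apply/eqP/(@inner_eq0 R A).
by rewrite innerBr exy subrr.
Qed.

Lemma inner_parallelogram x y :
  inner (x + y) (x + y) - inner (x - y) (x - y) =
  2%:R *: (inner x y + inner y x : A).
Proof.
rewrite innerBl !innerBr innerDl !innerDr addr_parallelogram.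
by rewrite scaler_nat.
Qed.

Lemma polarization x y :
  4%:R *: (inner x y : A) =
  (inner (x + y) (x + y) - inner (x - y) (x - y)) -
  'i%R *: (inner (x + 'i%R *: y) (x + 'i%R *: y) -
           inner (x - 'i%R *: y) (x - 'i%R *: y)).
Proof.
rewrite !inner_parallelogram innerZr innerZl conjCi scaleNr -scalerBr.
rewrite scalerA mulrC -!scalerA [_ *: (_ *: (_ - _))]scalerA.
rewrite -expr2 sqrCi scaleN1r.
by rewrite -scalerBr !opprB addrACA subrr addr0 -mulr2n !scaler_nat -mulrnA.
Qed.

End HilbertModule.

Section Seminorms.
Variable R : realType.

Lemma normc_norm (c : R[i]) : (Normc.normc c)%:C = `|c|.
Proof. by []. Qed.

Lemma normc_real (r : R) : 0 <= r -> Normc.normc r%:C = r.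
Proof. by move=> r0; rewrite /= expr0n addr0 sqrtr_sqr ger0_norm. Qed.

Lemma normc_nat n : Normc.normc (n%:R : R[i]) = n%:R.
Proof. by apply: complexI; rewrite normc_norm normr_nat rmorph_nat. Qed.

Lemma normcN1 : Normc.normc (-1 : R[i]) = 1.
Proof. by apply: complexI; rewrite normc_norm normrN1. Qed.

Lemma normc_conj (c : R[i]) : Normc.normc (Num.conj c) = Normc.normc c.
Proof. by apply: complexI; rewrite !normc_norm norm_conjC. Qed.

Lemma normc_i : Normc.normc ('i%R : R[i]) = 1.
Proof. by apply: complexI; rewrite normc_norm normCi. Qed.

Variables (A : proCStarType R) (p : A -> R).
Hypothesis Sp : cstar_seminorms A p.

Lemma cseminormD a b : p (a + b) <= p a + p b.
Proof. by have [[]] := Sp. Qed.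

Lemma cseminormZ (c : R[i]) a : p (c *: a) = Normc.normc c * p a.
Proof. by have [[]] := Sp. Qed.

Lemma cseminormN a : p (- a) = p a.
Proof. by rewrite -scaleN1r cseminormZ normcN1 mul1r. Qed.

Lemma cseminorm_ge0 a : 0 <= p a.
Proof.
have := cseminormD a (- a).
rewrite cseminormN subrr -(scale0r a) cseminormZ Normc.normc0 mul0r.
by rewrite -mulr2n pmulrn_lge0.
Qed.

Variable E : hilbertModType A.

Lemma hnormZ (c : R[i]) (x : E) :
  hnorm p (c *: x) = Normc.normc c * hnorm p x.
Proof.
have c0 : 0 <= Normc.normc c by case: c => a b; exact: sqrtr_ge0.
rewrite /hnorm innerZr innerZl !cseminormZ normc_conj mulrA -expr2.
by rewrite sqrtrM ?sqr_ge0// sqrtr_sqr ger0_norm.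
Qed.

Lemma hnormN (x : E) : hnorm p (- x) = hnorm p x.
Proof.
rewrite /hnorm -(scaleN1r x) innerZl innerZr rmorphN1 scalerA mulrNN mulr1.
by rewrite scale1r.
Qed.

Lemma hnorm_lt1 (x : E) : hnorm p x < 1 -> p (inner x x) <= 1.
Proof.
move=> hx; rewrite -(sqr_sqrtr (cseminorm_ge0 (inner x x))).
by rewrite expr_le1 ?sqrtr_ge0// ltW.
Qed.

End Seminorms.

(** * Continuity of the inner product *)

(** Addition is continuous at 0, so for small [x] and [y] the four vectors
    $x\pm y$, $x\pm iy$ of the polarization identity all lie in the unit ball
    of [hnorm p]. *)
Lemma inner_locally_bounded (R : realType) (A : proCStarType R)
    (E : hilbertModType A) (p : A -> R) : cstar_seminorms A p ->
  exists2 q, cstar_seminorms A q & exists2 d : R, 0 < d &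
    forall x y : E, hnorm q x < d -> hnorm q y < d -> p (inner x y) <= 1.
Proof.
move=> Sp; have ball1 : nbhs (0 + 0 : E) [set x : E | hnorm p x < 1].
  apply/nbhs_hilbertP; exists p => //; exists 1 => // y.
  by rewrite addr0 sub0r hnormN.
have [[N M] /= [N0 M0] NM] := @add_continuous E (0, 0) _ ball1.
have /nbhs_hilbertP[q Sq [d d0 qNM]] : nbhs (0 : E) (N `&` M) by exact: filterI.
exists q => //; exists d => // x y qx qy.
have small (z t : E) : hnorm q z < d -> hnorm q t < d ->
    p (inner (z + t) (z + t)) <= 1.
  move=> qz qt; apply: (hnorm_lt1 Sp); apply: (NM (z, t)); split=> /=.
    by have [] := qNM z; rewrite // sub0r hnormN.
  by have [] := qNM t; rewrite // sub0r hnormN.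
have qiy : hnorm q ('i%R *: y) < d by rewrite (hnormZ Sq) normc_i mul1r.
have neg (z : E) : hnorm q z < d -> hnorm q (- z) < d by rewrite hnormN.
have: p (4%:R *: inner x y) <= 4%:R.
  rewrite polarization.
  have tri a b : p (a - b) <= p a + p b.
    by rewrite -(cseminormN Sp b) (cseminormD Sp).
  apply: le_trans (tri _ _) _; rewrite (cseminormZ Sp) normc_i mul1r.
  have -> : 4%:R = (1 + 1) + (1 + 1) :> R by lra.
  by apply: lerD; apply: le_trans (tri _ _) _; apply: lerD; apply: small;
    rewrite ?neg.
rewrite (cseminormZ Sp) normc_nat => h4; lra.
Qed.

(** Local boundedness at the origin spreads by homogeneity in each variable. *)
Lemma inner_continuous (R : realType) (A : proCStarType R)
    (E : hilbertModType A) (u : E) : continuous (inner u : E -> A).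
Proof.
move=> x N /nbhs_procstarP[p Sp [e e0 pN]].
have [q Sq [d d0 pq]] := inner_locally_bounded E Sp.
have hu0 : 0 <= hnorm q u by exact: sqrtr_ge0.
(* [r *: u] and [s *: (x - y)] are made smaller than [d]; then
   p (inner u (x - y)) <= 1 / (r * s) = e / 2. *)
pose r := d / (hnorm q u + 1).
have r0 : 0 < r by rewrite divr_gt0// ltr_wpDl.
pose s := 2 / (r * e).
have s0 : 0 < s by rewrite divr_gt0// mulr_gt0.
apply/nbhs_hilbertP; exists q => //; exists (d / s); first by rewrite divr_gt0.
move=> y qxy; apply: pN; rewrite -innerBr.
have ru : hnorm q (r%:C *: u) < d.
  rewrite (hnormZ Sq) normc_real ?(ltW r0)// /r mulrAC ltr_pdivrMr ?ltr_wpDl//.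
  by rewrite ltr_pM2l// ltrDl.
have sxy : hnorm q (s%:C *: (x - y)) < d.
  by rewrite (hnormZ Sq) normc_real ?(ltW s0)// mulrC -ltr_pdivlMr.
have := pq _ _ ru sxy.
rewrite innerZl innerZr !(cseminormZ Sp) normc_conj.
rewrite !normc_real ?(ltW r0) ?(ltW s0)//.
set P := p _ => h; have -> : P = r * (s * P) * (e / 2).
  by rewrite /s; field; rewrite !gt_eqF.
by apply: (le_lt_trans (ler_wpM2r _ h)); lra.
Qed.

(** * Unitaries between modules with equal Gram matrices *)

Section Extension.
Variables (R : realType) (B : proCStarType R) (I : Type).
Implicit Types (G H : hilbertModType B).

(** The linear relation generated by [x i |-> y i].  Working with relations
    keeps the two modules symmetric and avoids showing beforehand that
    [x i |-> y i] respects linear dependence. *)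
Definition span_pair G H (x : I -> G) (y : I -> H) (u : G) (v : H) :=
  exists n (c : 'I_n -> R[i]) (s : 'I_n -> I),
    u = \sum_(i < n) c i *: x (s i) /\ v = \sum_(i < n) c i *: y (s i).

Definition closure_pair G H (x : I -> G) (y : I -> H) (g : G) (h : H) :=
  forall (N : set G) (M : set H), nbhs g N -> nbhs h M ->
    exists u v, [/\ span_pair x y u v, N u & M v].

Lemma span_pairC G H (x : I -> G) (y : I -> H) u v :
  span_pair x y u v -> span_pair y x v u.
Proof. by move=> [n [c [s [-> ->]]]]; exists n, c, s. Qed.

Lemma closure_pairC G H (x : I -> G) (y : I -> H) g h :
  closure_pair x y g h -> closure_pair y x h g.
Proof.
move=> xy N M Nh Mg; have [u [v [uv Mu Nv]]] := xy M N Mg Nh.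
by exists v, u; split=> //; apply: span_pairC.
Qed.

Lemma span_closure_pair G H (x : I -> G) (y : I -> H) u v :
  span_pair x y u v -> closure_pair x y u v.
Proof.
by move=> uv N M Nu Mv; exists u, v; split=> //; exact: nbhs_singleton.
Qed.

Lemma family_span_pair G H (x : I -> G) (y : I -> H) i :
  span_pair x y (x i) (y i).
Proof.
exists 1%N, (fun=> 1), (fun=> i).
by rewrite !big_ord1 !scale1r.
Qed.

Lemma inner_span_pair G H (x : I -> G) (y : I -> H) g h u v :
  (forall i, inner g (x i) = inner h (y i)) ->
  span_pair x y u v -> inner g u = inner h v.
Proof.
move=> gh [n [c [s [-> ->]]]]; rewrite !linear_sum; apply: eq_bigr => i _.
by rewrite /= !innerZr gh.
Qed.

Lemma inner_closure_pair G H (x : I -> G) (y : I -> H) g h u v :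
  (forall u v, span_pair x y u v -> inner g u = inner h v) ->
  closure_pair x y u v -> inner g u = inner h v.
Proof.
move=> gh xy; apply: procstar_hausdorff => N M Nu Mv.
have [u' [v' [uv' Nu' Mv']]] :=
  xy _ _ (inner_continuous Nu) (inner_continuous Mv).
by exists (inner g u'); split=> //; rewrite (gh _ v').
Qed.

Section Isometry.
Variables (G H : hilbertModType B) (x : I -> G) (y : I -> H).
Hypothesis gram : forall i j, inner (x i) (x j) = inner (y i) (y j).

(** Equality of the Gram matrices passes to linear combinations, and from there
    to limits; each time one argument of the inner product is freed first, and
    the other one by symmetry. *)
Lemma inner_span_pairs u v u' v' : span_pair x y u v -> span_pair x y u' v' ->
  inner u u' = inner v v'.
Proof.
move=> uv; apply: inner_span_pair => i.
rewrite -star_inner -[in RHS]star_inner; congr star.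
by apply: inner_span_pair uv => j.
Qed.

Lemma inner_closure_pairs g h g' h' :
  closure_pair x y g h -> closure_pair x y g' h' -> inner g g' = inner h h'.
Proof.
move=> gh; apply: inner_closure_pair => u v uv.
rewrite -star_inner -[in RHS]star_inner; congr star.
by apply: inner_closure_pair gh => u' v'; apply: inner_span_pairs.
Qed.

(** Two limits of the same vector are at zero distance since the relation
    preserves inner products. *)
Lemma closure_pair_inj g h h' :
  closure_pair x y g h -> closure_pair x y g h' -> h = h'.
Proof.
move=> gh gh'; apply/eqP; rewrite -subr_eq0; apply/eqP/(@inner_eq0 R B).
rewrite innerBl !innerBr.
rewrite -(inner_closure_pairs gh gh) -(inner_closure_pairs gh gh').
by rewrite -(inner_closure_pairs gh' gh) -(inner_closure_pairs gh' gh') !subrr.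
Qed.

(** The combinations of the [x i] close to [g] have counterparts in [H] that
    form a Cauchy filter, as the correspondence preserves all seminorms; its limit is
    related to [g]. *)
Lemma closure_pair_total : closed_span (range x) = [set: G] ->
  forall g, exists h, closure_pair x y g h.
Proof.
move=> spanx g.
have dense (N : set G) : nbhs g N -> exists u v, span_pair x y u v /\ N u.
  move=> Ng; have : closed_span (range x) g by rewrite spanx.
  move=> /(_ _ Ng) [u [[n [c [s [xs us]]]] Nu]].
  have {xs}/choice[f fx] : forall i, exists j, x j = s i.
    by move=> i; have [j _ <-] := xs i; exists j.
  exists u, (\sum_(i < n) c i *: y (f i)); split=> //; exists n, c, f; split=> //.
  by rewrite us; apply: eq_bigr => i _; rewrite fx.
pose F : set_system H := [set M | exists2 N : set G, nbhs g N &
  forall u v, span_pair x y u v -> N u -> M v].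
have FF : ProperFilter F.
  apply: Build_ProperFilter.
    by move=> [N /dense[u [v [uv Nu]]] NM]; exact: NM uv Nu.
  split.
  - by exists setT => //; exact: filterT.
  - move=> M M' [N Ng NM] [N' Ng' NM']; exists (N `&` N'); first exact: filterI.
    by move=> u v uv [Nu Nu']; split; [exact: NM uv Nu|exact: NM' uv Nu'].
  - move=> M M' MM' [N Ng NM]; exists N => // u v uv Nu.
    by apply: MM'; exact: NM uv Nu.
have cF : cauchy F.
  move=> D /hilbert_entourage[p Sp [e e0 pD]].
  have entE := hilbert_ball_entourage G Sp e0.
  pose W := split_ent [set xy : G * G | hnorm p (xy.1 - xy.2) < e].
  have entW : entourage W by exact: entourage_split_ent.
  (* both orientations of [W] let the triangle step go from [u] to [u'] via [g] *)
  pose N := xsection (W `&` W^-1%relation) g.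
  have Ng : nbhs g N.
    by apply: nbhs_entourage; apply: filterI => //; exact: entourage_inv.
  pose M := [set v | exists2 u, span_pair x y u v & N u].
  have FM : F M by exists N => // u v uv Nu; exists u.
  exists (M, M) => //= -[v v'] [/= [u uv Nu] [u' uv' Nu']]; apply: pD => /=.
  have : hnorm p (u - u') < e.
    move: Nu Nu'; rewrite /N /xsection /= !inE => -[_ Nu] [Nu' _].
    exact: (entourage_split g entE Nu Nu').
  rewrite /hnorm !innerBl !innerBr.
  rewrite (inner_span_pairs uv uv) (inner_span_pairs uv uv').
  by rewrite (inner_span_pairs uv' uv) (inner_span_pairs uv' uv').
have [h Fh] := hilbert_complete F FF cF.
exists h => N M Ng /Fh[N' Ng' NM].
have [u [v [uv [Nu Nu']]]] := dense _ (filterI Ng Ng').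
by exists u, v; split=> //; apply: NM uv Nu'.
Qed.
End Isometry.

(** The closures of the relation and of its converse are everywhere defined and
    single-valued.  The two resulting maps are adjoint to each other, and a map
    with an adjoint is automatically linear and compatible with the right
    action. *)
Lemma unitary_of_gram G H (x : I -> G) (y : I -> H) :
  (forall i j, inner (x i) (x j) = inner (y i) (y j)) ->
  closed_span (range x) = [set: G] -> closed_span (range y) = [set: H] ->
  exists2 U : adjop G H, unitary U & forall i, U (x i) = y i.
Proof.
move=> gram spanx spany.
have gramC i j : inner (y i) (y j) = inner (x i) (x j) by [].
have [U Ucl] := choice (closure_pair_total gram spanx).
have [U' Ucl'] := choice (closure_pair_total gramC spany).
have UU' g h : inner (U g) h = inner g (U' h).
  by rewrite (inner_closure_pairs gram (Ucl g) (closure_pairC (Ucl' h))).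
have U'U g h : inner (U' h) g = inner h (U g).
  by rewrite -star_inner -UU' star_inner.
have Ulin : linear U.
  move=> c g g'; apply: inner_eq => h.
  by rewrite innerDr innerZr -!U'U innerDr innerZr.
have Uract g b : U (ract g b) = ract (U g) b.
  by apply: inner_eq => h; rewrite inner_ract -!U'U inner_ract.
have Ubnd p : cstar_seminorms B p ->
    exists M : R, forall g, hnorm p (U g) <= M * hnorm p g.
  move=> Sp; exists 1 => g.
  by rewrite mul1r /hnorm (inner_closure_pairs gram (Ucl g) (Ucl g)).
exists (AdjOp Ulin Uract UU' Ubnd).
  split=> [g|h] /=.
    exact: (closure_pair_inj gramC (Ucl' _) (closure_pairC (Ucl _))).
  exact: (closure_pair_inj gram (Ucl _) (closure_pairC (Ucl' _))).
move=> i /=; apply: (closure_pair_inj gram (Ucl _)).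
by apply: span_closure_pair; exact: family_span_pair.
Qed.

End Extension.

(** * Adjointable operators *)

Section Adjointable.
Variables (R : realType) (B : proCStarType R).
Implicit Types G H K : hilbertModType B.

Lemma inner_adj G H (T : adjop G H) g h : inner (adj T h) g = inner h (T g).
Proof. by rewrite -star_inner -op_adj star_inner. Qed.

(** Pairing with [h] turns the operators into the maps [inner (adj T h)] and
    [inner (adj T' h)], which are linear and continuous whatever [h] is. *)
Lemma adjop_eq_on_closed_span G H (T T' : adjop G H) (X : set G) :
  closed_span X = [set: G] -> (forall x, X x -> T x = T' x) -> T =1 T'.
Proof.
move=> spanX TT' x; apply: inner_eq => h; rewrite -!inner_adj.
apply: (linear_eq_on_closed_span (f := inner (adj T h)) (g := inner (adj T' h))
  (@procstar_hausdorff R B) (@inner_continuous R B G _)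
  (@inner_continuous R B G _) spanX) => z Xz /=.
by rewrite !inner_adj TT'.
Qed.

Fact comp_linear G H K (T : adjop H K) (S : adjop G H) : linear (T \o S).
Proof. by move=> c g g' /=; rewrite !op_linear. Qed.

Fact comp_ract G H K (T : adjop H K) (S : adjop G H) g b :
  (T \o S) (ract g b) = ract ((T \o S) g) b.
Proof. by rewrite /= !op_ract. Qed.

Fact comp_adj G H K (T : adjop H K) (S : adjop G H) g k :
  inner ((T \o S) g) k = inner g ((adj S \o adj T) k).
Proof. by rewrite /= !op_adj. Qed.

Fact comp_bounded G H K (T : adjop H K) (S : adjop G H) p :
  cstar_seminorms B p ->
  exists M : R, forall g, hnorm p ((T \o S) g) <= M * hnorm p g.
Proof.
move=> Sp; have [M TM] := op_bounded T Sp; have [N SN] := op_bounded S Sp.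
exists (`|M| * N) => g; apply: le_trans (TM _) _.
apply: (@le_trans _ _ (`|M| * hnorm p (S g))).
  by rewrite ler_wpM2r ?ler_norm// sqrtr_ge0.
by rewrite -mulrA ler_wpM2l.
Qed.

Definition comp_adjop G H K (T : adjop H K) (S : adjop G H) : adjop G K :=
  AdjOp (comp_linear T S) (comp_ract T S) (comp_adj T S) (comp_bounded T S).

Section Coisometry.
Variables (G H : hilbertModType B) (W : adjop G H).
Hypothesis coisoW : coisometry W.

Lemma inner_coisometry_adj h h' : inner (adj W h) (adj W h') = inner h h'.
Proof. by rewrite inner_adj; congr inner; exact: coisoW. Qed.

Fact coisometry_adj_linear : linear (adj W).
Proof.
move=> c h h'; apply: inner_eq => g.
by rewrite innerDr innerZr -!op_adj innerDr innerZr.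
Qed.

Fact coisometry_adj_ract h b : adj W (ract h b) = ract (adj W h) b.
Proof. by apply: inner_eq => g; rewrite inner_ract -!op_adj inner_ract. Qed.

(** The adjoint of a coisometry is isometric, and therefore bounded without any
    comparison of the norms of an operator and of its adjoint. *)
Fact coisometry_adj_bounded p : cstar_seminorms B p ->
  exists M : R, forall h, hnorm p (adj W h) <= M * hnorm p h.
Proof.
by move=> _; exists 1 => h; rewrite mul1r /hnorm inner_coisometry_adj.
Qed.

Definition coisometry_adj : adjop H G :=
  AdjOp coisometry_adj_linear coisometry_adj_ract
    (fun h g => inner_adj W g h) coisometry_adj_bounded.
End Coisometry.

Lemma inner_unitary G H (U : adjop G H) g g' :
  unitary U -> inner (U g) (U g') = inner g g'.
Proof. by move=> [UU _]; rewrite op_adj; congr inner; exact: UU. Qed.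

End Adjointable.

(** * Uniqueness of the Stinespring construction *)

Section Stinespring.
Variables (R : realType) (A B : proCStarType R).
Variables (E : hilbertModType A) (F : hilbertModType B).

(** Polarization carries the equality of $\phi$ and $\psi$ from the elements
    $\langle x,x\rangle$ to all inner products, which span a dense subspace. *)
Lemma sim_phi_eq (phi psi : {linear A -> B}) (Phi Psi : E -> F) :
  full E -> CP_with phi Phi -> CP_with psi Psi -> sim Phi Psi -> phi =1 psi.
Proof.
move=> fullE [cphi _ mapPhi] [cpsi _ mapPsi] simPP.
apply: (linear_eq_on_closed_span (@procstar_hausdorff R B) cphi cpsi fullE).
have diag (x : E) : phi (inner x x) = psi (inner x x).
  by rewrite -mapPhi simPP mapPsi.
move=> _ [x [y ->]]; apply: (@scalerI _ _ (4%:R : R[i])).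
  by rewrite pnatr_eq0.
have: phi (4%:R *: inner x y) = psi (4%:R *: inner x y).
  rewrite polarization; rewrite !(linearB phi) !(linearB psi).
  rewrite [phi ('i *: _)]linearZ [psi ('i *: _)]linearZ /=.
  by rewrite !(linearB phi) !(linearB psi) !diag.
by rewrite !linearZ.
Qed.

Variables (D : twoSidedModType B) (d0 : D) (phi : A -> B) (Phi : E -> F).
Variable S : stinespring d0 phi Phi.

Lemma inner_pi_phi a d a' d' :
  inner (pi_phi S a (V_phi S d)) (pi_phi S a' (V_phi S d')) =
  inner d (tau D (phi (star a * a')) d').
Proof.
have [_ piM piS] := pi_phi_hom S.
by rewrite op_adj -piS op_adj (phi_dilation S) /= piM.
Qed.

Lemma inner_pi_Phi z d z' d' :
  inner (pi_Phi S z (V_phi S d)) (pi_Phi S z' (V_phi S d')) =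
  inner d (tau D (phi (inner z z')) d').
Proof.
rewrite op_adj -[adj _ _]/((adj (pi_Phi S z) \o pi_Phi S z') _) pi_Phi_inner.
by rewrite op_adj (phi_dilation S).
Qed.

Lemma inner_Phi z : inner (Phi z) (Phi z) =
  inner (pi_Phi S z (V_phi S d0)) (pi_Phi S z (V_phi S d0)).
Proof.
rewrite (Phi_dilation S) inner_coisometry_adj //.
exact: W_Phi_coisometry.
Qed.

Lemma closed_span_pi_phi : closed_span (range (fun ad : A * D =>
  pi_phi S ad.1 (V_phi S ad.2))) = [set: K_phi S].
Proof.
rewrite -(minimal1 S); congr closed_span; apply/seteqP; split=> k.
  by move=> [[a d] _ <-]; exists a, d.
by move=> [a [d ->]]; exists (a, d).
Qed.

Lemma closed_span_pi_Phi : closed_span (range (fun zd : E * D =>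
  pi_Phi S zd.1 (V_phi S zd.2))) = [set: K_Phi S].
Proof.
rewrite -(minimal2 S); congr closed_span; apply/seteqP; split=> k.
  by move=> [[a d] _ <-]; exists a, d.
by move=> [a [d ->]]; exists (a, d).
Qed.

End Stinespring.

(** The Gram matrices of the two spanning families depend on $\phi$ and [D]
    only. *)
Lemma stinespring_unique (R : realType) (A B : proCStarType R)
    (E : hilbertModType A) (F : hilbertModType B) (phi psi : A -> B)
    (Phi Psi : E -> F) (D : twoSidedModType B) (d0 : D)
    (S : stinespring d0 phi Phi) (T : stinespring d0 psi Psi) :
  phi =1 psi ->
  exists (U1 : adjop (K_phi S) (K_phi T)) (U2 : adjop (K_Phi S) (K_Phi T)),
    [/\ unitary U1, unitary U2, V_phi T =1 U1 \o V_phi S &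
        forall x : E, U2 \o pi_Phi S x =1 pi_Phi T x \o U1].
Proof.
move=> ephi.
have [|U1 uU1 U1E] :=
    unitary_of_gram _ (closed_span_pi_phi S) (closed_span_pi_phi T).
  by move=> [a d] [a' d'] /=; rewrite !inner_pi_phi ephi.
have [|U2 uU2 U2E] :=
    unitary_of_gram _ (closed_span_pi_Phi S) (closed_span_pi_Phi T).
  by move=> [z d] [z' d'] /=; rewrite !inner_pi_Phi ephi.
exists U1, U2; split=> // [d|x].
  (* $U_1V_\phi=V_\psi$ is the case $a=1$ *)
  by have /= := U1E (1, d); rewrite !pi_phi_unital.
apply: (@adjop_eq_on_closed_span _ _ _ _ (comp_adjop U2 (pi_Phi S x))
  (comp_adjop (pi_Phi T x) U1) _ (closed_span_pi_phi S)) => _ [[a d] _ <-] /=.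
(* $\pi_\Phi(x)\pi_\phi(a)V_\phi d=\pi_\Phi(xa)V_\phi d$ is a spanning vector of
   the second family *)
have := U2E (ract x a, d); rewrite /= !pi_Phi_ract /= => ->.
by rewrite (U1E (a, d)).
Qed.

Theorem corollary3p4 (R : realType) (A B : proCStarType R)
    (E : hilbertModType A) (hE : full E) (F : twoSidedModType B)
    (phi psi : {linear A -> B}) (Phi Psi : E -> F)
    (hPhi : CP_with phi Phi) (hPsi : CP_with psi Psi)
    (D : twoSidedModType B) (d0 : D)
    (SPhi : stinespring d0 phi Phi) (SPsi : stinespring d0 psi Psi) :
  sim Phi Psi <->
  exists (U1 : adjop (K_phi SPhi) (K_phi SPsi)) (U2 : adjop (K_Phi SPhi) (K_Phi SPsi))
         (V : adjop F F),
    unitary U1 /\ unitary U2 /\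
    V =1 adj (W_Phi SPhi) \o adj U2 \o W_Phi SPsi /\
    [/\ V_phi SPsi =1 U1 \o V_phi SPhi,
        forall x : E, U2 \o pi_Phi SPhi x =1 pi_Phi SPsi x \o U1 &
        W_Phi SPhi =1 adj U2 \o W_Phi SPsi \o adj V].
Proof.
split=> [simPP|[U1 [U2 [V [uU1 [uU2 [_ [U1V U2pi _]]]]]]] x].
  have [U1 [U2 [uU1 uU2 U1V U2pi]]] :=
    stinespring_unique SPhi SPsi (sim_phi_eq hE hPhi hPsi simPP).
  have coU2 : coisometry U2 by case: uU2.
  have coW : coisometry (W_Phi SPhi) by exact: W_Phi_coisometry.
  pose V := comp_adjop
    (comp_adjop (coisometry_adj coW) (coisometry_adj coU2)) (W_Phi SPsi).
  exists U1, U2, V.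
  do 3 split=> //; split=> // f /=.
  have /= -> := @W_Phi_coisometry _ _ _ _ _ _ _ _ _ SPsi (U2 (W_Phi SPhi f)).
  by have /= -> := uU2.1 (W_Phi SPhi f).
rewrite (inner_Phi SPhi) (inner_Phi SPsi) -(inner_unitary _ _ uU2).
by have /= -> := U2pi x (V_phi SPhi d0); rewrite U1V.
Qed.
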